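(* For every $n\in\mathbb{N}$, the Schreier family $\mathcal{S}_n$ admits an emulation, and so the Sierpiński space contains isometric copies of each Schreier space $X_{\mathcal{S}_n}$ of finite order. Furthermore, for every standard ladder system $\boldsymbol\xi$ and every $\alpha<\omega_1$, the family $\mathcal{S}^*_\alpha=\mathcal{S}^*_\alpha(\boldsymbol\xi)$ admits an emulation, and hence the Sierpiński space contains isometric copies of each Schreier$^*$ space $X_{\mathcal{S}^*_\alpha}$.
   Context: $\mathbb{N}=\{1,2,\dots\}$. $\mathrm{FHC}$ is the set of families $\mathcal{F}$ of finite subsets of $\mathbb{N}$ closed under subsets with $\bigcup\mathcal{F}=\mathbb{N}$. For $\mathcal{F}\in\mathrm{FHC}$, $\|x\|_{\mathcal{F}}=\sup\{\sum_{i\in F}|x(i)|:F\in\mathcal{F}\}$ and $X_{\mathcal{F}}=\{x\in\mathbb{R}^{\mathbb{N}}:\|x\cdot\chi_{[n,\infty)}\|_{\mathcal{F}}\to0\}$, a Banach space under $\|\cdot\|_{\mathcal{F}}$ with basis the unit vectors. For an injection $\theta:\mathbb{N}\to\mathbb{Q}$, let $\mathcal{C}_\theta$ be the family of finite sets $F\subseteq\mathbb{N}$ on which $\theta$ is increasing, $X_\theta=X_{\mathcal{C}_\theta}$, $\|\cdot\|_\theta=\|\cdot\|_{\mathcal{C}_\theta}$, with unit vector basis $(e_{\theta,n})$. When $\theta$ is a bijection $\mathbb{N}\to\mathbb{Q}$, $X_\theta$ is called a Sierpiński space; any two Sierpiński spaces contain isometric copies of each other, and the statement is about each of them. A pair $((I_n)_{n\in\mathbb{N}},\theta)$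 emulates $\mathcal{F}\in\mathrm{FHC}$ if the $I_n$ are pairwise disjoint non-empty (finite) intervals of $\mathbb{N}$, $\theta:\mathbb{N}\to\mathbb{Q}$ is an injection, and, with $x_n=\sum_{j\in I_n}e_{\theta,j}\in X_\theta$, for every finite $E\subseteq\mathbb{N}$: $\|\sum_{n\in E}x_n\|_\theta=|E|$ iff $E\in\mathcal{F}$. $\mathcal{F}$ admits an emulation if such a pair exists. For non-empty finite sets, $E<F$ means $\max E<\min F$, and $\{m\}\le F$ means $m\le\min F$. Define $\mathbf{S}(\mathcal{F})=\{\emptyset\}\cup\{\bigcup_{k=1}^mF_k:m\in\mathbb{N},\ F_k\in\mathcal{F}\setminus\{\emptyset\},\ \{m\}\le F_1<\dots<F_m\}$; $\mathbf{D}((\mathcal{F}_k)_k)=\{\emptyset\}\cup\{F:F\in\mathcal{F}_k\setminus\{\emptyset\}\text{ and }k\le\min F\text{ for some }k\in\mathbb{N}\}$; $\mathbf{D}^*((\mathcal{F}_k)_k)=\{\emptyset\}\cup\{\bigcup_{k=1}^mF_k:m\in\mathbb{N},\ F_k\in\mathcal{F}_k\setminus\{\emptyset\},\ \{m\}\le F_m<\dots<F_1\}$. A ladder system is $\boldsymbol\xi=((\xi^\gamma_k)_{k=1}^\infty:\gamma<\omega_1\text{ a limit ordinal})$ with $\xi^\gamma_1<\xi^\gamma_2<\dots<\gamma$ unbounded in $\gamma$ for each $\gamma$. Define recursively for $\alpha<\omega_1$: $\mathcal{S}_0(\boldsymbol\xi)=\mathcal{S}^*_0(\boldsymbol\xi)=\{F\subseteq\mathbb{N}:|F|\le1\}$;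 $\mathcal{S}_{\alpha+1}(\boldsymbol\xi)=\mathbf{S}(\mathcal{S}_\alpha(\boldsymbol\xi))$ and $\mathcal{S}^*_{\alpha+1}(\boldsymbol\xi)=\mathbf{S}(\mathcal{S}^*_\alpha(\boldsymbol\xi))$; for limit $\gamma$, $\mathcal{S}_\gamma(\boldsymbol\xi)=\mathbf{D}((\mathcal{S}_{\xi^\gamma_k}(\boldsymbol\xi))_k)$ and $\mathcal{S}^*_\gamma(\boldsymbol\xi)=\mathbf{D}^*((\mathcal{S}^*_{\xi^\gamma_k}(\boldsymbol\xi))_k)$. For finite $n$, $\mathcal{S}_n=\mathcal{S}_n(\boldsymbol\xi)$ does not depend on $\boldsymbol\xi$. $\boldsymbol\xi$ is standard if $\mathcal{S}_{\xi^\gamma_1}(\boldsymbol\xi)\subseteq\mathcal{S}_{\xi^\gamma_2}(\boldsymbol\xi)\subseteq\cdots$ for every limit $\gamma<\omega_1$. *)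

(* Defs.v *)
From HB Require Import structures.
From mathcomp Require Import all_boot all_order all_algebra finmap.
From mathcomp Require wochoice.
From mathcomp Require Import all_classical all_reals all_analysis.
Set Implicit Arguments. Unset Strict Implicit. Unset Printing Implicit Defensive.
Import Order.TTheory GRing.Theory Num.Theory.
Import numFieldNormedType.Exports.
Local Open Scope classical_set_scope.
Local Open Scope ring_scope.

(* The index set N = {1, 2, ...}; order and arithmetic go through nat. *)
Record posnat := PosNat { nat_of_posnat :> nat; _ : (0 < nat_of_posnat)%N }.
HB.instance Definition _ := [isSub for nat_of_posnat].
HB.instance Definition _ := [Countable of posnat by <:].

Definition pone : posnat := @PosNat 1 isT.

Definition family := set {fset posnat}.

Definition FHC (F : family) : Prop :=
  (forall A B : {fset posnat}, (A `<=` B)%fset -> F B -> F A) /\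
  \bigcup_(A in F) [set` A] = [set: posnat].

Section Spaces.
Variable R : realType.
Implicit Types (F G : family) (x y : posnat -> R).

(* Possibly +oo: x ranges over all sequences. *)
Definition fnorm F x : \bar R :=
  ereal_sup [set (\sum_(i <- A) `|x i|)%:E | A in F].

Definition tail x (n : nat) : posnat -> R :=
  fun i => if (n <= i)%N then x i else 0.

Definition Xspace F : set (posnat -> R) :=
  [set x | (fun n => fnorm F (tail x n)) @ \oo --> 0%E].

(* X_G contains a linear isometric copy of X_F; the values of T outside X_F
   are irrelevant. *)
Definition contains_isometric_copy G F : Prop :=
  exists T : (posnat -> R) -> (posnat -> R),
    [/\ forall x, Xspace F x -> Xspace G (T x),
        forall (a : R) x y, Xspace F x -> Xspace F y ->
          T (fun i => a * x i + y i) = (fun i => a * T x i + T y i)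
      & forall x, Xspace F x -> fnorm G (T x) = fnorm F x].

Definition unit_vec (j : posnat) : posnat -> R := fun i => (i == j)%:R.

End Spaces.

Definition increasing_family (theta : posnat -> rat) : family :=
  [set A | forall i j : posnat, i \in A -> j \in A ->
    (i < j)%N -> theta i < theta j].

Definition is_interval (A : {fset posnat}) : Prop :=
  forall i j k : posnat, i \in A -> k \in A -> (i <= j <= k)%N -> j \in A.

Definition emulates (R : realType) (I : posnat -> {fset posnat})
    (theta : posnat -> rat) (F : family) : Prop :=
  [/\ FHC F,
      forall n, I n != fset0 /\ is_interval (I n),
      forall m n, m != n -> [disjoint I m & I n]%fset,
      injective theta
    & forall E : {fset posnat},
        fnorm (increasing_family theta)
          (\sum_(n <- E) \sum_(j <- I n) @unit_vec R j) = (#|` E|%:R)%:E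
        <-> F E].

Definition admits_emulation (R : realType) (F : family) : Prop :=
  exists I theta, emulates R I theta F.

(* A < B; only used for non-empty sets, where it says max A < min B. *)
Definition fset_lt (A B : {fset posnat}) : Prop :=
  forall i j, i \in A -> j \in B -> (i < j)%N.

Definition le_fset (m : posnat) (A : {fset posnat}) : Prop :=
  forall i, i \in A -> (m <= i)%N.

(* In opS and opDstar the sets F_1, ..., F_m are the values G k with k <= m. *)
Definition opS (F : family) : family :=
  [set A | A = fset0 \/
    exists (m : posnat) (G : posnat -> {fset posnat}),
      [/\ forall k : posnat, (k <= m)%N -> F (G k) /\ G k != fset0,
          le_fset m (G pone),
          forall k l : posnat, (k < l <= m)%N -> fset_lt (G k) (G l)
        & [set` A] = \bigcup_(k in [set k : posnat | (k <= m)%N]) [set` G k]]].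

Definition opD (F : posnat -> family) : family :=
  [set A | A = fset0 \/
    exists k : posnat, [/\ F k A, A != fset0 & le_fset k A]].

Definition opDstar (F : posnat -> family) : family :=
  [set A | A = fset0 \/
    exists (m : posnat) (G : posnat -> {fset posnat}),
      [/\ forall k : posnat, (k <= m)%N -> F k (G k) /\ G k != fset0,
          le_fset m (G m),
          forall k l : posnat, (k < l <= m)%N -> fset_lt (G l) (G k)
        & [set` A] = \bigcup_(k in [set k : posnat | (k <= m)%N]) [set` G k]]].

Definition small_sets : family := [set A | (#|` A| <= 1)%N].

(* S_n for finite n; see transfinite_finite below. *)
Definition schreier_fin (n : nat) : family := iter n opS small_sets.

(* The ordinals below omega_1, up to order isomorphism: an uncountable
   well-order all of whose proper initial segments are countable. *)
Record omega1Type := Omega1 {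
  omega1_disp : Order.disp_t;
  omega1_order :> orderType omega1_disp;
  omega1_wf : well_founded (fun a b : omega1_order => (a < b)%O);
  omega1_countable : forall a : omega1_order, countable [set b | (b < a)%O];
  omega1_uncountable : ~ countable [set: omega1_order]
}.

(* omega1Type is inhabited: keep the elements with countably many predecessors
   in a well-ordering of the subsets of nat. *)
Section Omega1Inhabited.

Definition wo_rel : rel (set nat) := sval (wochoice.well_ordering_principle (set nat)).
Definition wo_relP : wochoice.well_order wo_rel := svalP _.

Definition omega1_carrier : Type :=
  {x : set nat | `[< countable [set y | wo_rel y x] >]}.
HB.instance Definition _ := Choice.on omega1_carrier.

Definition omega1_le (a b : omega1_carrier) : bool := wo_rel (sval a) (sval b).

Let total_rel x y : wo_rel x y || wo_rel y x.
Proof.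
have wo : wochoice.wo_chain wo_rel predT by move=> A _; apply: wo_relP.
exact: (wochoice.wo_chainW wo).
Qed.

Let anti_rel x y : wo_rel x y -> wo_rel y x -> x = y.
Proof.
have wo : wochoice.wo_chain wo_rel predT by move=> A _; apply: wo_relP.
by move=> xy yx; apply: (wochoice.wo_chain_antisymmetric wo) => //; rewrite xy yx.
Qed.

Let min_rel (A : set (set nat)) x : A x ->
  exists2 z, A z & forall y, A y -> wo_rel z y.
Proof.
move=> Ax; have [|z [[Az zle] _]] := wo_relP (A := fun y => `[< A y >]).
  by exists x; apply/asboolP.
exists z; first exact/asboolP.
by move=> y Ay; apply: zle; apply/asboolP.
Qed.

Let trans_rel y x z : wo_rel x y -> wo_rel y z -> wo_rel x z.
Proof.
move=> xy yz.
have [w] := @min_rel [set w | [\/ w = x, w = y | w = z]] x (Or31 _ _ erefl).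
case=> -> wle; first by apply: wle; apply: Or33.
  by rewrite (anti_rel xy) //; apply: wle; apply: Or31.
have zy : wo_rel z y by apply: wle; apply: Or32.
by rewrite -(anti_rel yz zy).
Qed.

Fact omega1_le_refl : reflexive omega1_le.
Proof. by move=> a; have := total_rel (sval a) (sval a); rewrite orbb. Qed.

Fact omega1_le_anti : antisymmetric omega1_le.
Proof. by move=> a b /andP[ab ba]; apply/val_inj/anti_rel. Qed.

Fact omega1_le_trans : transitive omega1_le.
Proof. by move=> b a c; apply: trans_rel. Qed.

Fact omega1_le_total : total omega1_le.
Proof. by move=> a b; apply: total_rel. Qed.

Fact omega1_display : Order.disp_t. Proof. exact: Order.Disp tt tt. Qed.

HB.instance Definition _ := Order.Le_isPOrder.Build omega1_display
  omega1_carrier omega1_le_refl omega1_le_anti omega1_le_trans.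
HB.instance Definition _ := Order.POrder_isTotal.Build omega1_display
  omega1_carrier omega1_le_total.

Lemma omega1_inhabited : inhabited omega1Type.
Proof.
constructor; apply: (@Omega1 omega1_display omega1_carrier).
- move=> a; apply: contrapT => na.
  pose A : set (set nat) := [set x | exists2 b : omega1_carrier, sval b = x &
    ~ Acc (fun c d : omega1_carrier => (c < d)%O) b].
  have [z [b <- nb] zle] := @min_rel A (sval a) (ex_intro2 _ _ a erefl na).
  apply: nb; constructor=> c; rewrite ltNge => /negP cb.
  by apply: contrapT => nc; apply: cb; apply: zle; exists c.
- move=> a; have /asboolP ca := svalP a; apply/countable_injP.
  have /countable_injP[f fi] := ca; exists (f \o sval) => b c.
  rewrite !inE /= => ba ca'; move=> /fi bc; apply: val_inj; apply: bc.
    by rewrite inE; apply: ltW ba.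
  by rewrite inE; apply: ltW ca'.
- move=> cT; pose A : set (set nat) := [set x | countable [set y | wo_rel y x]].
  have cA : countable A.
    suff -> : A = sval @` [set: omega1_carrier].
      by apply: sub_countable cT; apply: card_image_le.
    apply/seteqP; split=> [x Ax|_ [a _ <-]]; last by have /asboolP := svalP a.
    by exists (exist _ x (asboolT Ax)).
  have [[x nx]|AT] := pselect (exists x, ~ A x).
    have [z nz zle] := @min_rel [set y | ~ A y] x nx; apply: nz.
    have : countable (\bigcup_(b in [set: bool]) (if b then A else [set z])).
      by apply: bigcup_countable => // -[] _; [|apply: countable1].
    apply: sub_countable; apply: subset_card_le => y /= yz.
    have [Ay|/zle zy] := pselect (A y); first by exists true.
    by exists false => //=; apply: anti_rel.
  have /countable_injP[f fi] := cA.
  pose D : set nat := [set n | exists2 x : set nat, f x = n & ~ x n].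
  have AE x : x \in A by rewrite inE; apply: contrapT => nx; apply: AT; exists x.
  have [Df|nDf] := pselect (D (f D)); last by apply: (nDf); exists D.
  by have [x fx] := Df; rewrite (fi _ _ (AE x) (AE D) fx).
Qed.

End Omega1Inhabited.

Section Ordinals.
Variable O : omega1Type.
Implicit Types a b c : O.

Definition is_zero a : Prop := forall b, (a <= b)%O.

(* a = b + 1 *)
Definition is_succ b a : Prop := (b < a)%O /\ forall c, (c < a)%O -> (c <= b)%O.

Definition is_limit a : Prop :=
  ~ is_zero a /\ forall b, (b < a)%O -> exists2 c, (b < c)%O & (c < a)%O.

(* Only the values at limit ordinals matter. *)
Record ladder_system := LadderSystem {
  ladder :> O -> posnat -> O;
  ladder_lt : forall a k, is_limit a -> (ladder a k < a)%O;
  ladder_incr : forall a (j k : posnat), is_limit a -> (j < k)%N ->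
    (ladder a j < ladder a k)%O;
  ladder_unbounded : forall a b, is_limit a -> (b < a)%O ->
    exists k, (b < ladder a k)%O
}.

Section Hierarchy.
Variables (L : (posnat -> family) -> family) (xi : ladder_system).

Definition hierarchy_step a (rec : forall b, (b < a)%O -> family) : family :=
  [set A | [\/ is_zero a /\ small_sets A,
               exists b (h : (b < a)%O), is_succ b a /\ opS (rec b h) A
             | exists h : is_limit a,
                 L (fun k => rec (xi a k) (ladder_lt xi k h)) A]].

(* Transfinite recursion with opS at successors and L at limits. *)
Definition hierarchy : O -> family :=
  Fix (omega1_wf (o:=O)) (fun=> family) hierarchy_step.

Lemma hierarchyE a : hierarchy a =
  [set A | [\/ is_zero a /\ small_sets A,
               exists b, is_succ b a /\ opS (hierarchy b) A
             | is_limit a /\ L (fun k => hierarchy (xi a k)) A]].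
Proof.
rewrite {1}/hierarchy Fix_eq; last first.
  move=> b f g fg; congr hierarchy_step.
  by apply: functional_extensionality_dep => c;
     apply: functional_extensionality_dep => h.
rewrite -/hierarchy; apply/seteqP; split=> A /=.
  move=> [?|[b [_ [? ?]]]|[h ?]]; [exact: Or31|apply: Or32|exact: Or33].
  by exists b.
move=> [?|[b [ba ?]]|[h ?]]; [exact: Or31|apply: Or32|apply: Or33].
  by exists b, ba.1.
by exists h.
Qed.

Lemma hierarchy0 a : is_zero a -> hierarchy a = small_sets.
Proof.
move=> a0; rewrite hierarchyE; apply/seteqP; split=> A /=; last first.
  by move=> ?; apply: Or31.
case=> [[]//|[b [[ba _] _]]|[al _]].
  by have := a0 b; rewrite leNgt ba.
by case: al.1.
Qed.

Lemma hierarchyS a b : is_succ b a -> hierarchy a = opS (hierarchy b).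
Proof.
move=> ba; rewrite hierarchyE; apply/seteqP; split=> A /=; last first.
  by move=> ?; apply: Or32; exists b.
case=> [[a0 _]|[c [ca SA]]|[[_ al] _]].
- by have := a0 b; rewrite leNgt ba.1.
- suff -> : b = c by [].
  by apply/eqP; rewrite eq_le ba.2 ?ca.2 ?ca.1 ?ba.1.
- by have [c bc /ba.2] := al _ ba.1; rewrite leNgt bc.
Qed.

Lemma hierarchy_lim a : is_limit a ->
  hierarchy a = L (fun k => hierarchy (xi a k)).
Proof.
move=> al; rewrite hierarchyE; apply/seteqP; split=> A /=; last first.
  by move=> ?; apply: Or33.
case=> [[a0 _]|[b [ba _]]|[]//]; first by case: al.
by have [c bc /ba.2] := al.2 _ ba.1; rewrite leNgt bc.
Qed.

Fixpoint is_finite_ordinal (n : nat) a : Prop :=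
  if n is m.+1 then exists2 b, is_finite_ordinal m b & is_succ b a
  else is_zero a.

Lemma transfinite_finite n a :
  is_finite_ordinal n a -> hierarchy a = schreier_fin n.
Proof.
elim: n a => [|n IH] a /=; first exact: hierarchy0.
by move=> [b bn ba]; rewrite (hierarchyS ba) (IH _ bn).
Qed.

End Hierarchy.

Definition schreier := hierarchy opD.
Definition schreier_star := hierarchy opDstar.

Definition standard (xi : ladder_system) : Prop :=
  forall a, is_limit a -> forall j k : posnat, (j <= k)%N ->
    schreier xi (xi a j) `<=` schreier xi (xi a k).

End Ordinals.

(* Main.v *)
(** The norm of [\sum_(n in E) x_n] is [|E|] exactly when one can choose a position
    in each [I_n], [n \in E], along which theta increases.  So it suffices to find
    finite non-empty sets [Q n] of rationals such that [A] is in [F] iff there is a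
    strictly increasing selection [q n \in Q n] over [A]; writing each [Q n] in
    decreasing order, one after the other, gives the emulation once ties are broken.
    Such sets are produced by transfinite induction.  If the [Q k] serve [F k], place
    copies of the sets [Q k n] with [k <= n] in disjoint intervals of the line, with
    larger [k] further to the left: an increasing selection on [A] then cuts [A] into
    consecutive pieces in [F k], for decreasing [k], and the constraint [k <= n] says
    that [k] starts no higher than [min A].  This is D*, except that some pieces may
    be empty, which can be repaired since the [F k] are hereditary and contain the
    singletons; and S is the case of D* in which all the [F k] are equal. *)
Require Import Defs.
From mathcomp Require Import all_boot all_order all_algebra finmap.
From mathcomp Require Import all_classical all_reals all_analysis.
From mathcomp Require Import lra zify.
Set Implicit Arguments. Unset Strict Implicit. Unset Printing Implicit Defensive.
Import Order.TTheory GRing.Theory Num.Theory.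
Import numFieldNormedType.Exports.
Local Open Scope classical_set_scope.
Local Open Scope ring_scope.

(** * Families described by increasing rational selections *)

Definition realizable (F : Defs.family) : Prop :=
  exists Q : posnat -> seq rat, (forall n, Q n != [::]) /\
    forall A, F A <-> exists q : posnat -> rat,
      (forall n, n \in A -> q n \in Q n) /\
      forall n p, n \in A -> p \in A -> (n < p)%N -> q n < q p.

Lemma realizableW F (A B : {fset posnat}) :
  realizable F -> (A `<=` B)%fset -> F B -> F A.
Proof.
move=> [Q [_ QF]] /fsubsetP AB /QF[q [qQ qlt]]; apply/QF; exists q; split.
  by move=> n /AB; apply: qQ.
by move=> n p /AB nB /AB; apply: qlt.
Qed.

Lemma realizable1 F n : realizable F -> F [fset n]%fset.
Proof.
move=> [Q [Q0 QF]]; apply/QF; exists (fun p => head 0 (Q p)); split.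
  by move=> p _; have := Q0 p; case: (Q p) => //= a s _; rewrite mem_head.
by move=> i j /fset1P-> /fset1P->; rewrite ltnn.
Qed.

Lemma realizable0 F : realizable F -> F fset0.
Proof. by move=> Fr; apply: realizableW (realizable1 pone Fr); rewrite // fsub0set. Qed.

Lemma realizable_FHC F : realizable F -> FHC F.
Proof.
move=> Fr; split=> [A B|]; first exact: realizableW.
apply/seteqP; split=> // n _; exists [fset n]%fset; first exact: realizable1.
by rewrite /= fset11.
Qed.

(** A strictly increasing selection from copies of the single value 0 can involve at most one
    index. *)
Lemma realizable_small_sets : realizable small_sets.
Proof.
exists (fun=> [:: 0]); split=> // A; split=> [A1|[q [q0 qlt]]].
  exists (fun=> 0); split=> // n p nA pA np; exfalso.
  have : ([fset n; p] `<=` A)%fset.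
    by apply/fsubsetP => i /fset2P[]->.
  move/fsubset_leq_card; rewrite cardfs2.
  case: eqVneq => [nep|_ le2]; first by rewrite nep ltnn in np.
  by have := leq_trans le2 A1.
rewrite /small_sets /= leqNgt; apply/negP => A2.
have [n [p [nA pA pn]]] : exists n p, [/\ n \in A, p \in A & p != n].
  have /fset0Pn[n nA] : A != fset0 by rewrite -cardfs_gt0 ltnW.
  move: A2; rewrite (cardfsD1 n) nA ltnS cardfs_gt0 => /fset0Pn[p].
  by rewrite !inE => /andP[pn pA]; exists n, p.
have q00 i : i \in A -> q i = 0 by move/q0; rewrite inE => /eqP.
move: pn; rewrite -(inj_eq val_inj) /= neq_ltn => /orP[] np.
  by have := qlt _ _ pA nA np; rewrite !q00 // ltxx.
by have := qlt _ _ nA pA np; rewrite !q00 // ltxx.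
Qed.

(** * Levelings and the operations D* and S *)

(* [l n] is the index [k] of the piece of [A] containing [n]; the pieces with index
   below [l (min A)] may be empty. *)
Definition leveled (F : posnat -> Defs.family) (A : {fset posnat})
    (l : posnat -> posnat) :=
  [/\ forall n p, n \in A -> p \in A -> (n < p)%N -> (l p <= l n)%N,
      forall n, n \in A -> (l n <= n)%N
    & forall k, F k [fset n in A | l n == k]%fset].

Lemma fset_max (A : {fset posnat}) (P : pred posnat) n0 : n0 \in A -> P n0 ->
  exists2 n, n \in A & P n /\ forall p, p \in A -> P p -> (p <= n)%N.
Proof.
move=> n0A Pn0; pose a i := has (fun n : posnat => (val n == i) && P n) A.
have exa : exists i, a i.
  by exists (val n0); apply/hasP; exists n0; rewrite //= eqxx.
have bnd i : a i -> (i <= \max_(n <- A) val n)%N.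
  by move=> /hasP[n nA /andP[/eqP<- _]]; apply: leq_bigmax_seq.
case: (ex_maxnP exa bnd) => i /hasP[n nA /andP[/eqP <- Pn]] imax.
exists n => //; split=> // p pA Pp; apply: imax; apply/hasP.
by exists p; rewrite //= eqxx.
Qed.

Lemma fset_min (A : {fset posnat}) n0 : n0 \in A ->
  exists2 n, n \in A & forall p, p \in A -> (n <= p)%N.
Proof.
move=> n0A; pose a i := has (fun n : posnat => val n == i) A.
have exa : exists i, a i by exists (val n0); apply/hasP; exists n0 => /=.
case: (ex_minnP exa) => i /hasP[n nA /eqP <-] imin.
by exists n => // p pA; apply: imin; apply/hasP; exists p => /=.
Qed.

(** D* demands non-empty pieces, so the levels in use must form an initial segment. Each repair
    fills a gap with a singleton, which lies in every [F k], and otherwise only shrinks pieces; the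
    sum of the levels bounds the number of repairs. *)
Lemma leveled_gapless F A l : (forall k, realizable (F k)) -> leveled F A l ->
  exists2 l', leveled F A l' & forall n (k : posnat), n \in A -> (k < l' n)%N ->
    exists2 p, p \in A & l' p = k.
Proof.
move=> Fr; have [N] := ubnP (\sum_(n <- A) val (l n))%N.
elim: N l => // N IH l lN lA.
have [[n [k [nA kn gap]]]|nogap] := pselect (exists n (k : posnat),
    [/\ n \in A, (k < l n)%N & forall p, p \in A -> l p != k]); last first.
  exists l => // n k nA kn; apply: contrapT => gap; apply: nogap; exists n, k.
  by split=> // p pA; apply/eqP => lp; apply: gap; exists p.
have [lanti lle lF] := lA.
(* Moving the last element above the missing level [k] down to [k] decreases the
   sum of the levels. *)
have [m mA [km mmax]] := @fset_max A (fun p => k < l p)%N n nA kn.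
pose l' p := if p == m then k else l p.
have l'E p : p != m -> l' p = l p by rewrite /l' => /negPf->.
have l'm : l' m = k by rewrite /l' eqxx.
apply: (IH l').
  apply: (@leq_trans (\sum_(n <- A) val (l n))%N); last first.
    by rewrite -ltnS.
  rewrite (bigD1_seq m) //= [ltnRHS](bigD1_seq m) //= l'm.
  rewrite (eq_bigr (fun p => val (l p))) ?ltn_add2r // => p pm.
  by rewrite l'E.
split.
- move=> i j iA jA ij; rewrite /l'; case: (eqVneq i m) => [im|im]; last first.
    case: (eqVneq j m) => [jm|_]; last exact: lanti.
    by rewrite jm in ij; apply: ltnW; apply: leq_trans km _; apply: lanti.
  rewrite ifN; last by apply/eqP => jm; rewrite im jm ltnn in ij.
  (* By maximality of [m], the elements after it have level at most [k]. *)
  rewrite leqNgt; apply/negP => /(mmax _ jA); rewrite leqNgt.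
  by rewrite -im ij.
- move=> i iA; rewrite /l'; case: eqVneq => [->|_]; last exact: lle.
  by apply: leq_trans (lle _ mA); apply: ltnW.
- move=> j; have [->|jk] := eqVneq j k.
    apply: realizableW (realizable1 m (Fr k)); first exact: Fr.
    apply/fsubsetP => p; rewrite !inE /= /l' => /andP[pA].
    by case: (eqVneq p m) => // pm; rewrite (negPf (gap _ pA)).
  apply: realizableW (lF j); first exact: Fr.
  apply/fsubsetP => p; rewrite !inE /= /l' => /andP[->].
  by case: (eqVneq p m) => //= _; rewrite eq_sym (negPf jk).
Qed.

(** The level of a point is the index of its piece. Conversely, [leveled_gapless] removes the empty
    pieces below the top level, and the number of pieces is the level of the minimum of [A]. *)
Lemma opDstarP F A : (forall k, realizable (F k)) ->
  opDstar F A <-> exists l, leveled F A l.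
Proof.
move=> Fr; split=> [[->|[m [G [GF mG Glt /seteqP[AG GA]]]]]|[l0]].
- exists (fun=> pone); split=> // k.
  by apply: realizableW (realizable0 (Fr k)) => //; apply/fsubsetP => n; rewrite !inE.
- have /choice[l lP] n : exists k : posnat, n \in A -> (k <= m)%N /\ n \in G k.
    have [nA|_] := boolP (n \in A); last by exists pone.
    by have [k /= km nG] := AG n nA; exists k.
  exists l; split=> [n p nA pA np|n nA|k].
  + have [ln nG] := lP n nA; have [lp pG] := lP p pA.
    rewrite leqNgt; apply/negP => lnp.
    by have := Glt _ _ (introT andP (conj lnp lp)) p n pG nG; rewrite ltnNge ltnW.
  (* [G m] is the leftmost piece, so its lower bound [m] passes to all the others. *)
  + have [ln nG] := lP n nA; have [_ /fset0Pn[i iG]] := GF m (leqnn _).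
    move: ln; rewrite leq_eqVlt => /orP[/eqP/val_inj lnm|lnm].
      by rewrite lnm in nG *; apply: mG.
    apply: leq_trans (ltnW lnm) _; apply: leq_trans (mG i iG) _; apply: ltnW.
    by apply: (Glt (l n) m) => //; rewrite lnm leqnn.
  + have [km|mk] := leqP k m.
      apply: realizableW (GF k km).1 => //.
      by apply/fsubsetP => n; rewrite !inE /= => /andP[/lP[_ +] /eqP <-].
    apply: realizableW (realizable0 (Fr k)) => //.
    apply/fsubsetP => n; rewrite !inE /= => /andP[/lP[+ _] /eqP lk].
    by rewrite lk leqNgt mk.
move=> /(leveled_gapless Fr)[l [lanti lle lF] gapless].
have [->|/fset0Pn[n0 n0A]] := eqVneq A fset0; first by left.
have [n1 n1A n1min] := fset_min n0A.
have lmax n : n \in A -> (l n <= l n1)%N.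
  move=> nA; have := n1min n nA; rewrite leq_eqVlt => /orP[/eqP/val_inj->//|].
  exact: lanti.
right; exists (l n1), (fun k => [fset n in A | l n == k]%fset); split.
- move=> k; rewrite leq_eqVlt => kl; split=> //; apply/fset0Pn.
  have [p pA pk] : exists2 p, p \in A & l p = k.
    case/orP: kl => [/eqP/val_inj->|/gapless]; first by exists n1.
    exact.
  by exists p; rewrite !inE /= pA pk eqxx.
- move=> i; rewrite !inE /= => /andP[iA _].
  by apply: leq_trans (n1min i iA); apply: lle.
- move=> k p /andP[kp _] i j; rewrite !inE /= => /andP[iA /eqP ip] /andP[jA /eqP jk].
  rewrite ltnNge; apply/negP; rewrite leq_eqVlt => /orP[/eqP/val_inj ji|ji].
    by move: kp; rewrite -jk -ip ji ltnn.
  by have := lanti _ _ jA iA ji; rewrite ip jk leqNgt kp.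
- apply/seteqP; split=> [n /= nA|n [k _]] /=; last by rewrite !inE /= => /andP[].
  by exists (l n); rewrite /= ?lmax // !inE /= nA eqxx.
Qed.

(** The pieces run from left to right in [opS] and from right to left in [opDstar]; for a constant
    sequence of families, renumbering [k] as [m + 1 - k] exchanges the two. *)
Lemma opS_opDstar F : opS F = opDstar (fun=> F).
Proof.
(* The default [pone] is reached only for [k > m]. *)
pose rv (m k : posnat) : posnat := insubd pone (m.+1 - k)%N.
have rvE (m k : posnat) : (k <= m)%N -> rv m k = (m.+1 - k)%N :> nat.
  by move=> km; rewrite val_insubd subn_gt0 ltnS km.
have rvle (m k : posnat) : (k <= m)%N -> (rv m k <= m)%N.
  by move=> km; rewrite rvE // leq_subLR -add1n leq_add2r; case: k km.
have rvK (m k : posnat) : (k <= m)%N -> rv m (rv m k) = k.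
  by move=> km; apply: val_inj; rewrite /= rvE ?rvle // rvE // subKn // ltnW.
have rvm (m : posnat) : rv m m = pone by apply: val_inj; rewrite /= rvE // subSnn.
have rv1 (m : posnat) : rv m pone = m.
  by apply: val_inj; rewrite /= rvE ?subSS ?subn0 //; case: m.
have rvlt (m k l : posnat) : (k < l <= m)%N -> (rv m l < rv m k)%N.
  move=> /andP[kl lm]; rewrite !rvE //; last by apply: leq_trans (ltnW kl) lm.
  by rewrite ltn_sub2l // ltnS (leq_trans (ltnW kl)).
have bigE (m : posnat) (G : posnat -> {fset posnat}) :
    \bigcup_(k in [set k : posnat | (k <= m)%N]) [set` G k] =
    \bigcup_(k in [set k : posnat | (k <= m)%N]) [set` G (rv m k)].
  apply/seteqP; split=> n [k /= km nG].
    by exists (rv m k); rewrite /= ?rvle // rvK.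
  by exists (rv m k); rewrite //= rvle.
apply/seteqP; split=> A [->|[m [G [GF mG Glt AG]]]]; try by left.
  right; exists m, (fun k => G (rv m k)); split.
  - by move=> k km; apply: GF; apply: rvle.
  - by rewrite rvm.
  - move=> k l klm; apply: Glt; rewrite rvlt //= rvle //.
    by case/andP: klm => kl; apply: leq_trans; apply: ltnW.
  - by rewrite AG bigE.
right; exists m, (fun k => G (rv m k)); split.
- by move=> k km; apply: GF; apply: rvle.
- by rewrite rv1.
- move=> k l klm; apply: Glt; rewrite rvlt //= rvle //.
  by case/andP: klm => kl; apply: leq_trans; apply: ltnW.
- by rewrite AG bigE.
Qed.

(** * Closure under D* and S, and the two hierarchies *)

(** An order embedding of the rationals into the interval from -1 to 1, so that infinitely many
    copies of the line fit side by side. *)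
Definition squash (x : rat) : rat := x / (1 + `|x|).

Lemma squash_lt1 x : `|squash x| < 1.
Proof.
have x1 : 0 < 1 + `|x| by rewrite ltr_pwDl.
by rewrite /squash normrM normfV (gtr0_norm x1) ltr_pdivrMr // mul1r ltrDr.
Qed.

Lemma squash_lt : {mono squash : x y / x < y}.
Proof.
apply: leW_mono; apply: le_mono => x y xy.
have x1 : 0 < 1 + `|x| by rewrite ltr_pwDl.
have y1 : 0 < 1 + `|y| by rewrite ltr_pwDl.
rewrite /squash ltr_pdivrMr // mulrAC ltr_pdivlMr //.
by case: (ger0P x); case: (ger0P y); nra.
Qed.

Lemma realizable_opDstar F : (forall k, realizable (F k)) -> realizable (opDstar F).
Proof.
move=> Fr; have /choice[Q QP] := Fr.
(* The [k]-th copy fills the open interval of radius 1 around [-2k]; these intervals are disjoint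
   and move left as [k] grows. *)
pose lev (k : posnat) x := squash x - (2 * k)%:R.
have lev_mono k : {mono lev k : x y / x < y}.
  by move=> x y; rewrite /lev ltrD2r squash_lt.
have lev_lt (k k' : posnat) x y : (k' < k)%N -> lev k x < lev k' y.
  move=> kk; rewrite /lev; have := squash_lt1 x; have := squash_lt1 y.
  rewrite !ltr_norml => /andP[? ?] /andP[? ?].
  have : (2 * k' + 2)%:R <= (2 * k)%:R :> rat by rewrite ler_nat; lia.
  by rewrite natrD; lra.
(* Only the copies 1 to [n] contribute to [Q' n], which encodes the condition [l n <= n]. *)
pose Q' n := [seq lev k x | k <- [seq insubd pone i | i <- iota 1 (val n)], x <- Q k n].
have Q'P (n : posnat) z : z \in Q' n <->
    exists (k : posnat) x, [/\ (k <= n)%N, x \in Q k n & z = lev k x].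
  split=> [/allpairsPdep[k [x [/mapP[i]]]]|[k [x [kn xQ ->]]]].
    rewrite mem_iota => /andP[i0 iin] -> xQ ->; exists (insubd pone i), x; split=> //.
    by rewrite val_insubd i0 -ltnS.
  apply/allpairsPdep; exists k, x; split=> //; apply/mapP; exists (val k).
    by rewrite mem_iota add1n ltnS kn andbT; case: k {xQ kn}.
  by rewrite valKd.
exists Q'; split=> [n|A].
  have Q10 := (QP pone).1 n.
  have [x xQ] : exists x, x \in Q pone n.
    by case: (Q pone n) Q10 => // x s _; exists x; rewrite mem_head.
  have : lev pone x \in Q' n by apply/Q'P; exists pone, x; split=> //; case: n {Q10 xQ}.
  by case: (Q' n).
rewrite (opDstarP _ Fr); split=> [[l [lanti lle lF]]|[q [qQ qlt]]].
  have /choice[q qP] k := ((QP k).2 _).1 (lF k).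
  have mem n : n \in A -> n \in [fset p in A | l p == l n]%fset.
    by move=> nA; rewrite !inE /= nA eqxx.
  exists (fun n => lev (l n) (q (l n) n)); split.
    move=> n nA; apply/Q'P; exists (l n), (q (l n) n); split=> //; first exact: lle.
    exact/(qP _).1/mem.
  move=> n p nA pA np; have := lanti n p nA pA np.
  rewrite leq_eqVlt => /orP[/eqP/val_inj lnp|]; last exact: lev_lt.
  rewrite lnp lev_mono; apply: (qP _).2 => //; first exact: mem.
  by rewrite -lnp; apply: mem.
(* Conversely, the index of the copy containing the selected value is taken as the level; the pair
   chosen off [A] is arbitrary. *)
have /choice[lx lxP] n : exists kx : posnat * rat, n \in A ->
    [/\ (kx.1 <= n)%N, kx.2 \in Q kx.1 n & q n = lev kx.1 kx.2].
  have [nA|_] := boolP (n \in A); last by exists (pone, 0).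
  by have /Q'P[k [x ?]] := qQ n nA; exists (k, x).
exists (fun n => (lx n).1); split.
(* A rise in level would send the later value into an interval further left. *)
- move=> n p nA pA np; rewrite leqNgt; apply/negP => /lev_lt le.
  have := qlt _ _ nA pA np; have [_ _ ->] := lxP n nA; have [_ _ ->] := lxP p pA.
  by rewrite ltNge ltW.
- by move=> n /lxP[].
- move=> k; apply/(QP k).2; exists (fun n => (lx n).2); split.
    by move=> n; rewrite !inE /= => /andP[/lxP[_ + _] /eqP<-].
  move=> n p; rewrite !inE /= => /andP[nA /eqP kn] /andP[pA /eqP kp] np.
  have := qlt _ _ nA pA np; have [_ _ ->] := lxP n nA; have [_ _ ->] := lxP p pA.
  by rewrite kn kp lev_mono.
Qed.

Lemma realizable_opS F : realizable F -> realizable (opS F).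
Proof. by move=> Fr; rewrite opS_opDstar; apply: realizable_opDstar. Qed.

Lemma realizable_schreier_fin n : realizable (schreier_fin n).
Proof.
elim: n => [|n IH]; first exact: realizable_small_sets.
exact: realizable_opS.
Qed.

Lemma realizable_schreier_star (O : omega1Type) (xi : ladder_system O) alpha :
  realizable (schreier_star xi alpha).
Proof.
elim/(well_founded_ind (@omega1_wf O)): alpha => a IH.
have [a0|an0] := pselect (is_zero a).
  by rewrite /schreier_star hierarchy0 //; apply: realizable_small_sets.
have [al|nal] := pselect (is_limit a).
  rewrite /schreier_star hierarchy_lim //; apply: realizable_opDstar => k.
  by apply: IH; apply: ladder_lt.
(* An element that is neither least nor a limit has some [b] below it with nothing strictly between;
   by linearity it is the successor of [b]. *)
have [b ba] : exists b, is_succ b a.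
  apply: contrapT => nb; apply: nal; split=> // b ba; apply: contrapT => bc.
  apply: nb; exists b; split=> // c ca; rewrite leNgt; apply/negP => bltc.
  by apply: bc; exists c.
rewrite /schreier_star (hierarchyS _ _ ba); apply: realizable_opS.
by apply: IH; have [] := ba.
Qed.

(** * Order embeddings into an enumeration of the rationals *)

Definition succ_pos (i : nat) : posnat := PosNat (ltn0Sn i).

Lemma succ_posK i : (succ_pos i).-1 = i. Proof. by []. Qed.

Lemma pred_posK (n : posnat) : succ_pos n.-1 = n.
Proof. by apply: val_inj => /=; rewrite prednK //; case: n. Qed.

(** A value falling inside the current interval becomes its left endpoint, which the open interval
    excludes. *)
Lemma interval_avoid (theta : nat -> rat) N (a b : rat) : a < b ->
  exists a' b', [/\ a <= a', a' < b', b' <= b &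
    forall m, (m < N)%N -> ~~ (a' < theta m < b')].
Proof.
move=> ab; elim: N => [|N [a' [b' [aa ab' bb avoid]]]]; first by exists a, b.
have [/andP[aN Nb]|out] := boolP (a' < theta N < b').
  exists (theta N), b'; split=> //; first by apply: le_trans aa _; apply: ltW.
  move=> m; rewrite ltnS leq_eqVlt => /orP[/eqP->|mN]; first by rewrite ltxx.
  apply: contra (avoid m mN) => /andP[Nm ->]; rewrite andbT.
  exact: lt_trans Nm.
exists a', b'; split=> // m.
by rewrite ltnS leq_eqVlt => /orP[/eqP->|/avoid].
Qed.

(** The midpoint of a subinterval missed by the first [N] values can only be attained at a later
    index. *)
Lemma surj_interval (theta : nat -> rat) : (forall q, exists m, theta m = q) ->
  forall N (a b : rat), a < b -> exists2 m, (N <= m)%N & a < theta m < b.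
Proof.
move=> surj N a b /(interval_avoid theta N)[a' [b' [aa ab bb avoid]]].
have [m mE] := surj ((a' + b') / 2).
have am : a' < theta m by rewrite mE; lra.
have mb : theta m < b' by rewrite mE; lra.
exists m; last by rewrite (le_lt_trans aa am) (lt_le_trans mb bb).
by rewrite leqNgt; apply/negP => /avoid; rewrite am mb.
Qed.

Lemma cut_below (s : seq rat) (b : rat) : (forall x, x \in s -> x < b) ->
  exists2 a, a < b & forall x, x \in s -> x <= a.
Proof.
elim: s => [_|y s IH sb]; first by exists (b - 1) => //; lra.
have [x xs|a ab sa] := IH; first by apply: sb; rewrite inE xs orbT.
exists (Num.max a y); first by rewrite gt_max ab sb ?mem_head.
by move=> x; rewrite inE le_max => /orP[/eqP->|/sa->//]; rewrite lexx orbT.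
Qed.

Lemma cut_between (s t : seq rat) : (forall x y, x \in s -> y \in t -> x < y) ->
  exists a b, [/\ a < b, forall x, x \in s -> x <= a & forall y, y \in t -> b <= y].
Proof.
elim: t => [_|z t IH st].
  suff [a sa] : exists a, forall x, x \in s -> x <= a.
    by exists a, (a + 1); split=> //; lra.
  (* Here [t] is empty and any upper bound of [s] will do; one plus the sum of the absolute values
     is a strict one. *)
  have [|a _ sa] := @cut_below s (1 + \sum_(x <- s) `|x|); last by exists a.
  move=> x xs; rewrite (big_rem x) //=.
  have := ler_norm x; have : 0 <= \sum_(y <- rem x s) `|y| by apply: sumr_ge0.
  lra.
have [x y xs yt|a [b [ab sa tb]]] := IH; first by apply: st; rewrite // inE yt orbT.
have [x xs|a' ab' sa'] := @cut_below s (Num.min b z).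
  by rewrite lt_min (le_lt_trans (sa _ xs) ab) st ?mem_head.
exists a', (Num.min b z); split=> // y; rewrite inE ge_min.
by move=> /orP[/eqP->|/tb->//]; rewrite lexx orbT.
Qed.

(* Ties are broken against the index so that they create no increasing pair. *)
Definition before (v : nat -> rat) i j := (v i < v j) || (v i == v j) && (j < i)%N.

Lemma before_trans v : transitive (before v).
Proof.
rewrite /before => j i k /orP[ij|/andP[/eqP-> ji]] /orP[jk|/andP[/eqP<- kj]].
- by rewrite (lt_trans ij jk).
- by rewrite ij.
- by rewrite jk.
- by rewrite eqxx (ltn_trans kj ji) orbT.
Qed.

Lemma before_irr v i : before v i i = false.
Proof. by rewrite /before ltxx ltnn andbF. Qed.

(** One extension step in the style of Cantor: [s] lists the images of the first indices and [m] is
    the next image. The premise on [s] stands under the existential so that choice gives a function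
    of all lists. *)
Lemma order_embedding_step (theta : nat -> rat) v (s : seq nat) :
  (forall q, exists m, theta m = q) ->
  exists m : nat,
    (forall i j, (i < size s)%N -> (j < size s)%N -> before v i j ->
      theta (nth 0%N s i) < theta (nth 0%N s j)) ->
    (forall i, (i < size s)%N -> (nth 0%N s i < m)%N) /\
    (forall i j, (i <= size s)%N -> (j <= size s)%N -> before v i j ->
      theta (nth 0%N (rcons s m) i) < theta (nth 0%N (rcons s m) j)).
Proof.
move=> surj.
have [sP|nP] := pselect (forall i j, (i < size s)%N -> (j < size s)%N -> before v i j ->
      theta (nth 0%N s i) < theta (nth 0%N s j)); last by exists 0%N.
(* An index from [N] on exceeds every entry of [s], which keeps the embedding increasing. *)
pose N := (\max_(k <- s) k).+1; set n := size s.
pose lo := [seq theta (nth 0%N s i) | i <- iota 0 n & before v i n].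
pose hi := [seq theta (nth 0%N s i) | i <- iota 0 n & before v n i].
have [x y /mapP[i]|a [b [ab loa hib]]] := @cut_between lo hi.
  rewrite mem_filter mem_iota add0n => /andP[iN /= ilt] -> /mapP[j].
  rewrite mem_filter mem_iota add0n => /andP[jN /= jlt] ->.
  by apply: sP => //; apply: before_trans iN jN.
have [m Nm /andP[am mb]] := surj_interval surj N ab.
exists m => _; split=> [i ilt|i j].
  by apply: leq_trans Nm; rewrite ltnS; apply: leq_bigmax_seq; rewrite ?mem_nth.
rewrite !nth_rcons leq_eqVlt => /orP[/eqP->|ilt].
  rewrite -/n ltnn eqxx leq_eqVlt => /orP[/eqP->|jlt]; first by rewrite before_irr.
  move=> nj; rewrite jlt; apply: lt_le_trans mb _; apply: hib.
  by apply/mapP; exists j; rewrite // mem_filter nj mem_iota.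
rewrite ilt leq_eqVlt => /orP[/eqP->|jlt] ij.
  rewrite ltnn eqxx; apply: le_lt_trans am; apply: loa.
  by apply/mapP; exists i; rewrite // mem_filter ij mem_iota.
by rewrite jlt; apply: sP.
Qed.

(** Since [before v] is a strict total order, the one implication already fixes the order of the
    values along [phi]. *)
Lemma order_embedding (theta v : nat -> rat) : (forall q, exists m, theta m = q) ->
  exists phi : nat -> nat, {homo phi : i j / (i < j)%N} /\
    forall i j, before v i j -> theta (phi i) < theta (phi j).
Proof.
move=> surj.
have /choice[next nextP] (s : seq nat) := order_embedding_step v s surj.
pose s := fix s n := if n is n'.+1 then rcons (s n') (next (s n')) else [::].
have sz n : size (s n) = n by elim: n => //= n IH; rewrite size_rcons IH.
have sP n i j : (i < n)%N -> (j < n)%N -> before v i j ->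
    theta (nth 0%N (s n) i) < theta (nth 0%N (s n) j).
  elim: n i j => // n IH i j; rewrite !ltnS => i_n j_n.
  by have [|_] := nextP (s n); rewrite sz //; apply.
have sE n i : (i < n)%N -> nth 0%N (s n) i = next (s i).
  elim: n => // n IH; rewrite ltnS /= nth_rcons sz leq_eqVlt => /orP[/eqP->|ilt].
    by rewrite ltnn eqxx.
  by rewrite ilt IH.
exists (fun i => next (s i)); split=> [i j ij|i j ij].
  have [|+ _] := nextP (s j); first by rewrite sz; apply: sP.
  by move=> /(_ i); rewrite sz sE //; apply.
have iM : (i < (maxn i j).+1)%N by rewrite ltnS leq_maxl.
have jM : (j < (maxn i j).+1)%N by rewrite ltnS leq_maxr.
by rewrite -(sE _ _ iM) -(sE _ _ jM); apply: sP.
Qed.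

(** * Blocks of positions and codings *)

(** Position [j] lies in block [b j] and carries the value [v j]. Sorting each block downwards
    prevents increasing pairs inside it; repeated entries of [Q n] are kept, hence the weak
    inequality. *)
Lemma concat_blocks (Q : posnat -> seq rat) : (forall n, Q n != [::]) ->
  exists (b : posnat -> posnat) (v : posnat -> rat),
    [/\ forall i j : posnat, (i <= j)%N -> (b i <= b j)%N,
        forall q n, q \in Q n <-> exists2 j, b j = n & v j = q
      & forall i j : posnat, (i < j)%N -> b i = b j -> v j <= v i].
Proof.
move=> Q0; pose K i := sort >=%O (Q (succ_pos i)).
have K0 i : (0 < size (K i))%N.
  by rewrite size_sort lt0n size_eq0.
(* Counting from 0, block [i] occupies the positions from [off i] up to, but excluding,
   [off i.+1]. *)
pose off i := (\sum_(k < i) size (K k))%N.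
have offS i : off i.+1 = (off i + size (K i))%N by rewrite /off big_ord_recr.
have off_mono : {homo off : i j / (i <= j)%N}.
  by apply: homo_leq => [//|j i k|i]; [apply: leq_trans|rewrite offS leq_addr].
have off_lt j : exists i, (j < off i.+1)%N.
  exists j; elim: j => [|j IH]; first by rewrite offS ltn_addl.
  by rewrite offS -addn1; apply: leq_add.
pose blk j := ex_minn (off_lt j).
have blk_lt j : (j < off (blk j).+1)%N by rewrite /blk; case: ex_minnP.
have blk_min j i : (j < off i.+1)%N -> (blk j <= i)%N.
  by rewrite /blk; case: ex_minnP => k _ kmin /kmin.
have blk_ge j : (off (blk j) <= j)%N.
  rewrite leqNgt; apply/negP; case E: (blk j) => [|i]; first by rewrite /off big_ord0.
  by move=> /blk_min; rewrite E ltnn.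
have blkE j i : (off i <= j)%N -> (j < off i.+1)%N -> blk j = i.
  move=> le lt; apply/eqP; rewrite eqn_leq blk_min //= leqNgt; apply/negP => ltb.
  by have := leq_trans (leq_trans (blk_lt j) (off_mono _ _ ltb)) le; rewrite ltnn.
pose val j := nth 0 (K (blk j)) (j - off (blk j)).
exists (fun j => succ_pos (blk j.-1)), (fun j => val j.-1); split.
- move=> i j ij; rewrite /= ltnS; apply: blk_min.
  by apply: leq_ltn_trans (blk_lt j.-1); lia.
- move=> q n; split=> [qQ|[j <- <-]].
    have qK : q \in K n.-1 by rewrite mem_sort pred_posK.
    have lt : (off n.-1 + index q (K n.-1) < off n.-1.+1)%N.
      by rewrite offS ltn_add2l index_mem.
    have bE := blkE _ _ (leq_addr _ _) lt.
    exists (succ_pos (off n.-1 + index q (K n.-1))); rewrite succ_posK.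
      by rewrite bE pred_posK.
    by rewrite /val bE addKn nth_index.
  rewrite -(mem_sort >=%O) mem_nth // -/(K _).
  by rewrite ltn_subLR // -offS.
- move=> i j ij /(congr1 (fun n : posnat => n.-1)); rewrite !succ_posK => bE.
  rewrite /val -bE.
  have ig := blk_ge i.-1; have jg := blk_ge j.-1; have jl := blk_lt j.-1.
  rewrite -bE in jg jl.
  have srt : sorted >=%O (K (blk i.-1)) by apply: sort_sorted => x y; apply: le_total.
  apply: (sorted_leq_nth (leT := >=%O) _ _ 0 srt) => //.
  + by move=> y x z /= yx zy; apply: le_trans zy yx.
  + by move=> x /=.
  + by rewrite inE ltn_subLR // -offS.
  + by rewrite inE ltn_subLR // -offS.
  + by rewrite leq_sub2r // -!subn1 leq_sub2r // ltnW.
Qed.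

(* [S] is the set of positions in use, and the fibres of [b] on [S] play the role
   of the blocks [I_n]. *)
Definition coding (F : Defs.family) (theta : posnat -> rat) (S : set posnat)
    (b : posnat -> posnat) :=
  [/\ forall i j : posnat, S i -> S j -> (i <= j)%N -> (b i <= b j)%N,
      forall i j : posnat, S i -> S j -> (i < j)%N -> b i = b j -> theta j < theta i,
      forall n : posnat, exists m : posnat, forall i : posnat,
        S i -> (m <= i)%N -> (n <= b i)%N
    & forall A : {fset posnat}, F A <-> exists s : posnat -> posnat,
      (forall n, n \in A -> S (s n) /\ b (s n) = n) /\
      forall n p, n \in A -> p \in A -> (n < p)%N -> theta (s n) < theta (s p)].

(** Breaking ties by [before] turns the weak inequality of [concat_blocks] into a strict one, and
    makes [theta \o phi] injective even if [theta] repeats values. *)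
Lemma coding_exists F (theta : posnat -> rat) : realizable F ->
    (forall q, exists m, theta m = q) ->
  exists (phi : posnat -> posnat) (b : posnat -> posnat),
    [/\ {homo phi : i j / (i < j)%N}, injective (theta \o phi) &
      coding F (theta \o phi) setT b].
Proof.
move=> [Q [Q0 QF]] surj; have [b [v [bmono bQ vdec]]] := concat_blocks Q0.
have [|phi [phi_lt phi_theta]] :=
    @order_embedding (theta \o succ_pos) (v \o succ_pos).
  by move=> q; have [m <-] := surj q; exists m.-1; rewrite /= pred_posK.
pose phi' (i : posnat) := succ_pos (phi i.-1).
have before_lt (i j : posnat) :
    before (v \o succ_pos) i.-1 j.-1 -> theta (phi' i) < theta (phi' j).
  exact: phi_theta.
have lt_phi i j : v i < v j -> theta (phi' i) < theta (phi' j).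
  by move=> ij; apply: before_lt; rewrite /before /= !pred_posK ij.
have gt_phi (i j : posnat) : (i < j)%N -> v j <= v i -> theta (phi' j) < theta (phi' i).
  move=> ij; rewrite le_eqVlt => /orP[/eqP E|/lt_phi//]; apply: before_lt.
  rewrite /before /= !pred_posK E eqxx ltxx /=.
  by case: i j ij {E} => [[|i] ?] [[|j] ?].
have surj_b n : exists j, b j = n.
  have := Q0 n; case E: (Q n) => [//|q s] _.
  by have [|j] := (bQ q n).1; [rewrite E mem_head|exists j].
exists phi', b; split.
- move=> i j ij; rewrite /= ltnS; apply: phi_lt.
  by case: i j ij => [[|i] ?] [[|j] ?].
- move=> i j /= E; apply: val_inj; case: (ltngtP i j) => // lt.
    have [/lt_phi|/(gt_phi _ _ lt)] := ltP (v i) (v j); by rewrite E ltxx.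
  by have [/lt_phi|/(gt_phi _ _ lt)] := ltP (v j) (v i); rewrite E ltxx.
- split=> /=.
  + by move=> i j _ _; apply: bmono.
  + by move=> i j _ _ ij /(vdec _ _ ij); apply: gt_phi.
  (* Every block is inhabited and [b] is monotone, so [b] tends to infinity. *)
  + move=> n; have [m mE] := surj_b n; exists m => i _ mi.
    by rewrite -mE; apply: bmono.
  + move=> A; rewrite QF; split=> [[q [qQ qlt]]|[s [sb slt]]].
      have /choice[s sP] (n : posnat) : exists j, n \in A -> b j = n /\ v j = q n.
        have [nA|_] := boolP (n \in A); last by exists pone.
        by have [j bj vj] := (bQ _ _).1 (qQ n nA); exists j.
      exists s; split=> [n /sP[]//|n p nA pA np]; apply: lt_phi.
      by rewrite (sP n nA).2 (sP p pA).2; apply: qlt.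
    exists (v \o s); split=> [n nA|n p nA pA np] /=.
      by apply/bQ; exists (s n) => //; apply: (sb n nA).2.
    have sn_sp : (s n < s p)%N.
      rewrite ltnNge; apply/negP => /bmono; rewrite (sb n nA).2 (sb p pA).2.
      by rewrite leqNgt np.
    rewrite ltNge; apply/negP => /(gt_phi _ _ sn_sp); apply/negP.
    by rewrite -leNgt ltW // slt.
Qed.

Lemma homo_ltn_ge (phi : posnat -> posnat) : {homo phi : i j / (i < j)%N} ->
  forall i j : posnat, (phi i <= phi j)%N -> (i <= j)%N.
Proof.
by move=> h i j; apply: contraTT; rewrite -!ltnNge => /h.
Qed.

(** A prescribed [theta] cannot be re-enumerated along [phi]; instead position [i] moves to [phi i],
    and the positions outside the range of [phi] stay empty. *)
Lemma coding_transfer F theta (phi b : posnat -> posnat) :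
  {homo phi : i j / (i < j)%N} -> coding F (theta \o phi) setT b ->
  exists b', coding F theta (range phi) b'.
Proof.
move=> hphi [bmono bdec bfin bF].
have phi_ge := homo_ltn_ge hphi.
have phi_inj : injective phi.
  move=> i j E; apply: val_inj; apply/eqP; rewrite eqn_leq.
  by apply/andP; split; apply: phi_ge; rewrite E.
have /choice[psi psiP] i : exists j, range phi i -> phi j = i.
  by have [[j _ <-]|ni] := pselect (range phi i); [exists j|exists pone].
have psiK : cancel phi psi by move=> i; apply/phi_inj/psiP; exists i.
exists (b \o psi); split=> [_ _ [i _ <-] [j _ <-]|_ _ [i _ <-] [j _ <-]|n|A] /=.
- by rewrite !psiK => /phi_ge; apply: bmono.
- rewrite !psiK => ij; apply: bdec => //.
  by rewrite ltnNge; apply: contraTN ij; rewrite -leqNgt leq_eqVlt =>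
    /orP[/eqP/val_inj->//|/hphi/ltnW].
- have [m mP] := bfin n; exists (phi m) => _ [i _ <-]; rewrite psiK.
  by move=> /phi_ge; apply: mP.
- rewrite bF; split=> [[s [sb slt]]|[s [sb slt]]].
    exists (phi \o s); split=> [n nA|] //=.
    by rewrite psiK; split; [exists (s n)|apply: (sb n nA).2].
  exists (psi \o s); split=> [n nA|n p nA pA np] /=; first by have [] := sb n nA.
  by rewrite !psiP; [apply: slt|have [] := sb p pA|have [] := sb n nA].
Qed.

(** * Isometric transport and the norm criterion for emulation *)

Section Isometry.
Variable R : realType.
Implicit Types (F : Defs.family) (x y : posnat -> R).

(** The linear operator taking the [n]-th unit vector to the indicator of the [n]-th block. *)
Definition transport (S : set posnat) (b : posnat -> posnat) x : posnat -> R :=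
  fun i => if i \in S then x (b i) else 0.

Lemma fnorm_ge F x (A : {fset posnat}) :
  F A -> ((\sum_(i <- A) `|x i|)%:E <= fnorm F x)%E.
Proof. by move=> FA; apply: ereal_sup_ubound; exists A. Qed.

Lemma fnorm_le F x z :
  (forall A, F A -> ((\sum_(i <- A) `|x i|)%:E <= z)%E) -> (fnorm F x <= z)%E.
Proof. by move=> h; apply: ge_ereal_sup => _ [A FA <-]; apply: h. Qed.

Lemma fnorm_ge0 F x : F fset0 -> (0 <= fnorm F x)%E.
Proof. by move=> /(fnorm_ge x); rewrite big_seq_fset0. Qed.

Lemma fnorm_mono F x y : (forall i, `|x i| <= `|y i|) -> (fnorm F x <= fnorm F y)%E.
Proof.
move=> xy; apply: fnorm_le => A FA; apply: le_trans (fnorm_ge y FA).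
by rewrite lee_fin; apply: ler_sum.
Qed.

Lemma sum_image (f : posnat -> posnat) (A : {fset posnat}) x :
  {in A &, injective f} ->
  \sum_(i <- [fset f n | n in A]%fset) `|x i| = \sum_(n <- A) `|x (f n)|.
Proof.
move=> finj; rewrite (perm_big [seq f n | n <- A]); last first.
  apply: uniq_perm; rewrite ?map_inj_in_uniq ?fset_uniq //.
  move=> i; apply/imfsetP/mapP => [[n nA ->]|[n nA ->]]; by exists n.
by rewrite big_map.
Qed.

(** An increasing set meets each block at most once, because [theta] decreases inside blocks, and
    the indices of the blocks met form a member of [F]. Conversely, an increasing selection over a
    member of [F] is an increasing set. So the two suprema bound each other, even when infinite. *)
Lemma fnorm_transport F theta S b x : coding F theta S b ->
  fnorm (increasing_family theta) (transport S b x) = fnorm F x.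
Proof.
move=> [bmono bdec _ FP]; apply/eqP; rewrite eq_le; apply/andP; split.
  apply: fnorm_le => A Ainc; pose A' := [fset i in A | i \in S]%fset.
  have A'P i : i \in A' -> i \in A /\ S i.
    by rewrite !inE /= => /andP[iA]; rewrite inE.
  have bneq i j : i \in A' -> j \in A' -> (i < j)%N -> b i <> b j.
    move=> /A'P[iA iS] /A'P[jA jS] ij bij.
    by have := Ainc _ _ iA jA ij; rewrite ltNge ltW // bdec.
  have binj : {in A' &, injective b}.
    move=> i j iA jA bij; apply: val_inj; case: (ltngtP i j) => // ij.
      by case: (bneq _ _ iA jA ij).
    by case: (bneq _ _ jA iA ij).
  have -> : \sum_(i <- A) `|transport S b x i| = \sum_(i <- A') `|x (b i)|.
    rewrite big_fset /= [LHS]big_mkcond [RHS]big_mkcond /=; apply: eq_bigr => i _.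
    by rewrite /transport; case: ifP; rewrite ?normr0.
  rewrite -(sum_image x binj); apply: fnorm_ge; apply/FP.
  have /choice[s sP] n : exists i, n \in [fset b i | i in A']%fset ->
      i \in A' /\ b i = n.
    have [/imfsetP[i iA ->]|_] := boolP (n \in _); last by exists pone.
    by exists i.
  exists s; split=> [n /sP[/A'P[]]|n p /sP[nA' bn] /sP[pA' bp] np] //.
  have [nA nS] := A'P _ nA'; have [pA pS] := A'P _ pA'.
  apply: Ainc => //; rewrite ltnNge; apply/negP => /(bmono _ _ pS nS).
  by rewrite bn bp leqNgt np.
apply: fnorm_le => A /FP[s [sb slt]].
have sinj : {in A &, injective s}.
  by move=> n p nA pA snp; rewrite -(sb n nA).2 -(sb p pA).2 snp.
have -> : \sum_(n <- A) `|x n| = \sum_(n <- A) `|transport S b x (s n)|.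
  rewrite big_seq [RHS]big_seq; apply: eq_bigr => n nA.
  by have [nS bn] := sb n nA; rewrite /transport ifT ?inE // bn.
rewrite -sum_image //; apply: fnorm_ge.
move=> _ _ /imfsetP[n nA ->] /imfsetP[p pA ->] snp.
apply: slt => //; have [nS bn] := sb n nA; have [pS bp] := sb p pA.
(* Blocks follow one another, so the earlier position belongs to the smaller index. *)
have := bmono _ _ nS pS (ltnW snp); rewrite bn bp leq_eqVlt.
by case/orP => // /eqP/val_inj E; rewrite E ltnn in snp.
Qed.

(** Far enough out, all positions of [S] lie in blocks beyond [N], so a tail of the transported
    sequence is dominated by the transport of a tail of [x]. *)
Lemma Xspace_transport F theta S b x : realizable F -> coding F theta S b ->
  Xspace F x -> Xspace (increasing_family theta) (transport S b x).
Proof.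
move=> Fr cF xF A [e /= e0 eA].
have e0A : nbhs (0%E : \bar R) [set z | (z < e%:E)%E].
  by exists e => //= r /=; rewrite sub0r normrN lte_fin => /ltr_normlW.
have [N _ NP] := xF _ e0A.
have [_ _ bfin _] := cF; have [m mP] := bfin (succ_pos N).
exists (val m) => // M /= mM.
have g0 : (0 <= fnorm (increasing_family theta) (tail (transport S b x) M))%E.
  by apply: fnorm_ge0 => i j; rewrite inE.
have gf : (fnorm (increasing_family theta) (tail (transport S b x) M) <=
           fnorm F (tail x N))%E.
  rewrite -(fnorm_transport _ cF); apply: fnorm_mono => i.
  rewrite /tail /transport; case: ifP => [Mi|_]; last by rewrite normr0.
  case: ifP => [|_]; last by rewrite normr0.
  rewrite inE => iS; have := mP i iS (leq_trans mM Mi).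
  by move=> /ltnW ->.
have ge := le_lt_trans gf (NP N (leqnn _)).
move: g0 ge; case: (fnorm _ _) => [r||]//=.
rewrite lee_fin lte_fin => r0 re; apply: eA.
by rewrite /= sub0r normrN ger0_norm.
Qed.

Lemma isometric_copy F (theta : posnat -> rat) : realizable F -> bijective theta ->
  contains_isometric_copy R (increasing_family theta) F.
Proof.
move=> Fr [psi _ psiK].
have [|phi [b [phi_lt _ cF]]] := @coding_exists F theta Fr.
  by move=> q; exists (psi q).
have [b' cF'] := coding_transfer phi_lt cF.
exists (transport (range phi) b'); split.
- by move=> x; apply: Xspace_transport.
- move=> a x y _ _; apply/funext => i; rewrite /transport.
  by case: ifP => // _; rewrite mulr0 addr0.
- by move=> x _; apply: fnorm_transport.
Qed.

(** The sum over a member [A] of [F] is the integer [|A & E|], which reaches [|E|] only if [A]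
    contains [E]; if no member does and [E] is non-empty, the supremum is at most [|E| - 1]. *)
Lemma fnorm_indicator F (E : {fset posnat}) : FHC F ->
  fnorm F (fun i => (i \in E)%:R : R) = (#|` E|%:R)%:E <-> F E.
Proof.
move=> [Fsub Fcov].
have sumE (A : {fset posnat}) :
    \sum_(i <- A) `|(i \in E)%:R : R| = #|` (A `&` E)%fset|%:R.
  have -> : (A `&` E = [fset i in A | i \in E])%fset.
    by apply/fsetP => i; rewrite !inE.
  rewrite card_fset_sum1 natr_sum -big_fset_condE [RHS]big_mkcond.
  by apply: eq_bigr => i _; case: ifP; rewrite ?normr1 ?normr0.
split=> [nE|FE].
  apply: contrapT => nFE.
  (* The predecessor is truncated at 0, so the empty set is treated apart: it lies below any member
     of [F]. *)
  have [E0|E_neq0] := eqVneq E fset0.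
    have [A FA _] : (\bigcup_(A in F) [set` A]) pone by rewrite Fcov.
    by apply: nFE; rewrite E0; apply: Fsub FA; apply: fsub0set.
  have : (fnorm F (fun i => (i \in E)%:R : R) <= (#|` E|.-1%:R)%:E)%E.
    apply: fnorm_le => A FA; rewrite lee_fin sumE ler_nat -ltnS prednK ?cardfs_gt0 //.
    rewrite ltnNge; apply/negP => le; apply: nFE; apply: Fsub FA.
    have /eqP <- : (A `&` E)%fset == E by rewrite eqEfcard fsubsetIr.
    exact: fsubsetIl.
  by rewrite nE lee_fin ler_nat leqNgt prednK ?cardfs_gt0 // leqnn.
apply/eqP; rewrite eq_le; apply/andP; split.
  apply: fnorm_le => A FA; rewrite lee_fin sumE ler_nat.
  by apply: fsubset_leq_card; apply: fsubsetIr.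
by have := fnorm_ge (fun i => (i \in E)%:R : R) FE; rewrite sumE fsetIid.
Qed.

Lemma realizable_emulation F : realizable F -> admits_emulation R F.
Proof.
(* A surjection onto the rationals that may repeat values, since numbers encoding nothing give 0;
   injectivity is gained by composing with [phi]. *)
move=> Fr; pose theta (n : posnat) : rat := odflt 0 (choice.unpickle n.-1).
have [|phi [b [_ theta_inj cF]]] := @coding_exists F theta Fr.
  move=> q; exists (succ_pos (choice.pickle q)).
  by rewrite /theta succ_posK choice.pickleK.
have [bmono _ bfin FP] := cF.
have fib n : finite_set [set i | b i = n].
  have [m mP] := bfin (succ_pos n).
  apply: (@sub_finite_set _ _ [set` [fset succ_pos k | k in iota 0 m]%fset]) => //.
  move=> i /= bi; apply/imfsetP; exists i.-1; last by rewrite pred_posK.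
  rewrite /= mem_iota add0n /=; apply: leq_ltn_trans (leq_pred _) _.
  rewrite ltnNge; apply/negP => /(mP i I).
  by rewrite bi /= ltnn.
pose In n := fset_set [set i | b i = n].
have InP n i : (i \in In n) = (b i == n).
  by rewrite in_fset_set //; apply/idP/eqP; rewrite inE.
exists In, (theta \o phi); split=> //.
- exact: realizable_FHC.
- move=> n; split=> [|i j k].
    have [s [sb _]] := (FP _).1 (realizable1 n Fr).
    by apply/fset0Pn; exists (s n); rewrite InP (sb n (fset11 n)).2.
  rewrite !InP => /eqP bi /eqP bk /andP[/(bmono _ _ I I) ij /(bmono _ _ I I) jk].
  apply/eqP/val_inj/eqP; rewrite eqn_leq; apply/andP; split.
    by rewrite -[in leqRHS]bk.
  by rewrite -[in leqLHS]bi.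
- move=> m n mn; apply/fdisjointP => i; rewrite !InP => /eqP->.
  exact: mn.
(* The sum of the block vectors over [E] is the transport of the indicator of [E], so its norm is
   that of the indicator with respect to [F]. *)
- move=> E; rewrite -(fnorm_indicator _ (realizable_FHC Fr)).
  rewrite -(fnorm_transport _ cF); set y := \sum_(n <- E) _.
  suff -> : y = transport setT b (fun i => (i \in E)%:R : R) by [].
  apply/funext => i; rewrite /y /transport ifT ?inE // fct_sumE.
  transitivity (\sum_(n <- E) ((b i == n)%:R : R)).
    apply: eq_bigr => n _; rewrite fct_sumE.
    rewrite -InP /unit_vec; have [iI|iI] := boolP (i \in In n).
      rewrite (bigD1_seq i) ?fset_uniq //= eqxx big1 ?addr0 // => j.
      by rewrite eq_sym => /negPf->.
    rewrite big1_seq // => j /andP[_ jI].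
    by case: eqVneq => // ij; rewrite ij jI in iI.
  have [bE|bE] := boolP (b i \in E).
    rewrite (bigD1_seq (b i)) ?fset_uniq //= eqxx big1 ?addr0 // => j.
    by rewrite eq_sym => /negPf->.
  rewrite big1_seq // => j /andP[_ jE].
  by case: eqVneq => // bj; rewrite bj jE in bE.
Qed.

End Isometry.

Theorem corollary6p9 (R : realType) :
  (forall n : nat, (0 < n)%N ->
     admits_emulation R (schreier_fin n) /\
     forall theta : posnat -> rat, bijective theta ->
       contains_isometric_copy R (increasing_family theta) (schreier_fin n)) /\
  (forall (O : omega1Type) (xi : ladder_system O), standard xi ->
     forall alpha : O,
       admits_emulation R (schreier_star xi alpha) /\
       forall theta : posnat -> rat, bijective theta ->
         contains_isometric_copy R (increasing_family theta)
           (schreier_star xi alpha)).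
Proof.
split=> [n _|O xi _ alpha].
  have Sr := realizable_schreier_fin n.
  by split=> [|theta]; [apply: realizable_emulation|apply: isometric_copy].
have Sr := realizable_schreier_star xi alpha.
by split=> [|theta]; [apply: realizable_emulation|apply: isometric_copy].
Qed.
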